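(* Let $k\ge 1$ be an integer and let $m(k)=4$ if $k\equiv 0$ or $3 \pmod 4$, and $m(k)=3$ otherwise. Then for every integer $n\ge 1$, \[ \overline{p}_{k}(n)\equiv \begin{cases} -2k, & \text{if } n \text{ is an even square};\\ 2k, & \text{if } n \text{ is an odd square};\\ 2k(k+1), & \text{if } n \text{ is twice a square};\\ 0, & \text{otherwise} \end{cases} \pmod{2^{m(k)}}. \]
   Context: An overpartition of $n$ is a partition of $n$ in which the first occurrence of each distinct part may (or may not) be overlined. An overpartition $k$-tuple of $n$ is a $k$-tuple $(\omega_1,\dots,\omega_k)$ of overpartitions whose parts together sum to $n$. $\overline{p}_k(n)$ denotes the number of overpartition $k$-tuples of $n$, with $\overline{p}_k(0)=1$; equivalently $\sum_{n\ge0}\overline{p}_k(n)q^n=\big((-q;q)_\infty/(q;q)_\infty\big)^k=1/\varphi(-q)^k$, where $(a;q)_\infty=\prod_{n\ge0}(1-aq^n)$ and $\varphi(q)=\sum_{n=-\infty}^{\infty}q^{n^2}$. *)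

(* Defs.v *)
From HB Require Import structures.
From mathcomp Require Import all_boot all_order all_algebra.

Set Implicit Arguments.
Unset Strict Implicit.
Unset Printing Implicit Defensive.

(* A list of parts, each with a flag telling whether it is overlined. *)
Notation marked_seq := (seq (nat * bool)).

Definition parts (s : marked_seq) : seq nat := [seq x.1 | x <- s].

Definition weight (s : marked_seq) : nat := sumn (parts s).

(* [index] returns the position of the first occurrence, so the last conjunct
   says that an overlined part is the first occurrence of its value. *)
Definition is_overpartition (s : marked_seq) : bool :=
  [&& sorted geq (parts s), all (fun a => 0 < a) (parts s)
    & [forall i : 'I_(size s),
        (nth (0, false) s i).2 ==>
          (index (nth (0, false) s i).1 (parts s) == i)]].

Definition is_overpartition_tuple (n : nat) (t : seq marked_seq) : bool :=
  all is_overpartition t && (sumn [seq weight s | s <- t] == n).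

(* An overpartition of an integer at most n has at most n parts, all at most n,
   so it lives in the finite type [bounded_marked_seq n]; see
   [overpartition_tuple_bounded] and [unbound_inj]. *)
Definition bounded_marked_seq (n : nat) : finType := n.-bseq ('I_n.+1 * bool)%type.

Definition unbound (n : nat) (b : bounded_marked_seq n) : marked_seq :=
  [seq (val x.1, x.2) | x <- bseqval b].

Definition overpartition_tuples (k n : nat) : {set k.-tuple (bounded_marked_seq n)} :=
  [set w : k.-tuple (bounded_marked_seq n) |
    is_overpartition_tuple n [seq unbound b | b <- w]].

Definition overp (k n : nat) : nat := #|overpartition_tuples k n|.

Definition modexp (k : nat) : nat :=
  if (k %% 4 == 0) || (k %% 4 == 3) then 4 else 3.

Definition is_square (n : nat) : Prop := exists j : nat, n = j ^ 2.

Definition is_twice_square (n : nat) : Prop := exists j : nat, n = 2 * j ^ 2.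

Lemma unbound_inj (n : nat) : injective (@unbound n).
Proof.
move=> b c /inj_map e; apply/val_inj/e.
by move=> [i x] [j y] /= [/val_inj -> ->].
Qed.

Lemma size_leq_sumn (s : seq nat) : all (fun a => 0 < a) s -> size s <= sumn s.
Proof.
by elim: s => //= a s IH /andP[a0 /IH h]; rewrite -add1n leq_add.
Qed.

Lemma mem_leq_sumn (s : seq nat) (a : nat) : a \in s -> a <= sumn s.
Proof.
elim: s => //= b s IH; rewrite inE => /orP[/eqP->|/IH h]; first exact: leq_addr.
exact: leq_trans h (leq_addl _ _).
Qed.

Lemma overpartition_bounded (n : nat) (s : marked_seq) :
  is_overpartition s -> weight s <= n ->
  exists b : bounded_marked_seq n, unbound b = s.
Proof.
case/and3P=> _ pos _ ws.
have sz : size [seq (inord x.1 : 'I_n.+1, x.2) | x <- s] <= n.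
  rewrite size_map -(size_map fst); exact: leq_trans (size_leq_sumn pos) ws.
exists (Bseq sz); rewrite /unbound /= -map_comp -[RHS]map_id.
apply/eq_in_map=> -[a x] sx /=; rewrite inordK // ltnS.
apply: leq_trans ws; apply: mem_leq_sumn.
exact: (map_f fst sx).
Qed.

Lemma overpartition_tuple_bounded (k n : nat) (t : seq marked_seq) :
  size t = k -> is_overpartition_tuple n t ->
  exists2 w, w \in overpartition_tuples k n & [seq unbound b | b <- w] = t.
Proof.
move=> st ht.
have [r er] : exists r : seq (bounded_marked_seq n), [seq unbound b | b <- r] = t.
  case/andP: ht => + /eqP/eq_leq; elim: t {st} => [|s t IH] /=; first by exists [::].
  case/andP=> os ot le_n.
  have [b eb] := overpartition_bounded os (leq_trans (leq_addr _ _) le_n).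
  have [r er] := IH ot (leq_trans (leq_addl _ _) le_n).
  by exists (b :: r); rewrite /= eb er.
have sr : size r == k by rewrite -st -er size_map.
by exists (Tuple sr); rewrite ?inE /= ?er.
Qed.

(* Main.v *)
(* With S = sum_(j >= 1) (-1)^j q^(j^2), Gauss's identity says that the generating
   function P of overpartitions satisfies P (1 + 2 S) = 1.  Hence
   P^k = 1 - 2k S + 4 C(k+1,2) S^2 - 8 C(k+2,3) S^3 modulo 16, where S^2 is
   sum_(j >= 1) q^(2 j^2) modulo 2; when k = 0 or 3 modulo 4, both C(k+1,2) and
   C(k+2,3) are even.
   Gauss's identity follows from Shanks' finite version of it, whose two sides are
   polynomials and whose error term is divisible by q^(n+1); everything takes place
   in polynomials over int, up to the coefficient of q^n. *)
Require Import Defs.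
From mathcomp Require Import all_boot all_order all_algebra.
From mathcomp Require Import zify ring.

Import GRing.Theory.
Local Open Scope ring_scope.

(** * Enumerating overpartitions by largest part *)

(** Only the first occurrence of a part may be overlined, so an overlined part must be strictly
    smaller than what precedes it. The relation is transitive, so comparing neighbours is enough. *)
Definition follows (x y : nat * bool) : bool :=
  (y.1 <= x.1)%N && (y.2 ==> (y.1 < x.1)%N).

Lemma follows_trans : transitive follows.
Proof.
move=> [a u] [b v] [c w]; rewrite /follows /= => /andP[h1 h2] /andP[h3 h4].
by case: w h4 => /= h4; lia.
Qed.

Lemma first_occurrencesP (s : marked_seq) :
  [forall i : 'I_(size s), (nth (0%N, false) s i).2 ==>
     (index (nth (0%N, false) s i).1 (parts s) == i)]
  = pairwise (fun x y => y.2 ==> (y.1 != x.1)) s.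
Proof.
elim: s => [|x s IH] /=; first by apply/forallP => -[].
rewrite -IH; apply/forallP/andP => [h|[/(all_nthP (0%N, false)) hx /forallP hs]].
  split.
    apply/(all_nthP (0%N, false)) => i lt_i.
    have lt_i1 : (i.+1 < size (x :: s))%N by [].
    have /implyP/= hi := h (Ordinal lt_i1).
    by apply/implyP => /hi; apply: contraTneq => ->; rewrite eqxx.
  apply/forallP => i; have lt_i1 : (i.+1 < size (x :: s))%N by case: i.
  have /implyP/= hi := h (Ordinal lt_i1).
  by apply/implyP => /hi; case: ifP.
case=> [[|i] lt_i] /=; first by rewrite eqxx implybT.
have /implyP hxi := hx i lt_i; have /implyP hsi := hs (Ordinal (lt_i : (i < size s)%N)).
by apply/implyP => ov; rewrite [x.1 == _]eq_sym (negPf (hxi ov)) eqSS; exact: hsi.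
Qed.

Lemma is_overpartitionE (s : marked_seq) :
  is_overpartition s = sorted follows s && all (fun x => 0 < x.1)%N s.
Proof.
rewrite /is_overpartition first_occurrencesP all_map andbCA andbC; congr andb.
rewrite (sorted_pairwise follows_trans) sorted_map.
rewrite sorted_pairwise; last by move=> a b c /= h1 h2; exact: leq_trans h2 h1.
rewrite -pairwise_relI; apply: eq_pairwise => x y /=.
by rewrite /follows /relpre /geq /=; case: y.2 => //=; lia.
Qed.

(** The free predicate [A] absorbs the bound imposed by a head, so that the tail of a list is an
    object of the same kind. *)
Definition overpartition_in (A : pred (nat * bool)) (n : nat) (s : marked_seq) : bool :=
  [&& sorted follows s, all A s & weight s == n].

Lemma overpartition_in_cons (A : pred (nat * bool)) (n : nat) (x : nat * bool) (s : marked_seq) :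
  overpartition_in A n (x :: s) =
  [&& A x, (x.1 <= n)%N & overpartition_in (fun y => A y && follows x y) (n - x.1) s].
Proof.
rewrite /overpartition_in /= (path_sortedE follows_trans).
have -> : all (fun y => A y && follows x y) s = all A s && all (follows x) s := all_predI _ _ _.
have -> : (weight (x :: s) == n) = (x.1 <= n)%N && (weight s == n - x.1)%N.
  rewrite /weight /=; lia.
by case: (A x); case: (all A s); case: (all (follows x) s); case: (sorted _ s);
  case: (x.1 <= n)%N; rewrite /= ?andbF.
Qed.

Lemma eq_overpartition_in (A B : pred (nat * bool)) (n : nat) (s : marked_seq) :
  A =1 B -> overpartition_in A n s = overpartition_in B n s.
Proof. by move=> AB; rewrite /overpartition_in (eq_all AB). Qed.

Definition parts_upto (m : nat) (x : nat * bool) : bool := (0 < x.1 <= m)%N.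

(* [follows] ignores the mark of its first argument, so [false] stands for either. *)
Definition parts_after (m : nat) (x : nat * bool) : bool := (0 < x.1)%N && follows (m, false) x.

(** Any number of plain copies of m+1 comes first, then a list from [E], meant to have parts at most
    m. Each copy lowers [n], so the fuel [f] suffices once [n <= f]. *)
Fixpoint enum_after (E : nat -> seq marked_seq) (m f n : nat) : seq marked_seq :=
  E n ++ if f is f'.+1 then
           if (m < n)%N then [seq (m.+1, false) :: s | s <- enum_after E m f' (n - m.+1)]
           else [::]
         else [::].

Fixpoint enum_upto (m n : nat) : seq marked_seq :=
  if m is m'.+1 then
    enum_upto m' n ++
    (if (m' < n)%N then
       [seq (m'.+1, true) :: s | s <- enum_after (enum_upto m') m' n (n - m'.+1)] ++
       [seq (m'.+1, false) :: s | s <- enum_after (enum_upto m') m' n (n - m'.+1)]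
     else [::])
  else if n == 0%N then [:: [::]] else [::].

Lemma mem_map_cons (x y : nat * bool) (s : marked_seq) (e : seq marked_seq) :
  (x :: s \in [seq y :: t | t <- e]) = (x == y) && (s \in e).
Proof.
apply/mapP/andP => [[t te [-> ->]]|[/eqP -> se]]; last by exists s.
by rewrite eqxx.
Qed.

Lemma nil_notin_map_cons (y : nat * bool) (e : seq marked_seq) :
  ([::] \in [seq y :: t | t <- e]) = false.
Proof. by apply/mapP => -[]. Qed.

Lemma mem_enum_after (m f n : nat) (s : marked_seq) :
  (forall n s, (s \in enum_upto m n) = overpartition_in (parts_upto m) n s) ->
  (n <= f)%N ->
  (s \in enum_after (enum_upto m) m f n) = overpartition_in (parts_after m.+1) n s.
Proof.
move=> IHm; elim: f n s => [|f IHf] n s le_nf /=.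
  rewrite cats0 IHm; case: s => // x s.
  rewrite !overpartition_in_cons /parts_upto /parts_after /follows /=; lia.
rewrite mem_cat IHm; case: s => [|x s].
  by case: ifP; rewrite ?nil_notin_map_cons orbF.
have -> : (x :: s \in if (m < n)%N then
    [seq (m.+1, false) :: t | t <- enum_after (enum_upto m) m f (n - m.+1)] else [::])
   = [&& x == (m.+1, false), (m < n)%N & overpartition_in (parts_after m.+1) (n - m.+1) s].
  case: ifP => mn; last by rewrite andbF.
  by rewrite mem_map_cons IHf //; lia.
rewrite !overpartition_in_cons; case: x => a u.
(* A head at most m can only come from the first list, a larger one only from the second, where it
   is a plain m+1. *)
have [/= le_am|lt_ma] := leqP a m.
  rewrite (_ : (a, u) == (m.+1, false) = false); last first.
    by apply/negbTE/eqP => -[]; lia.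
  rewrite orbF.
  rewrite (_ : parts_upto m (a, u) = parts_after m.+1 (a, u)); last first.
    by rewrite /parts_upto /parts_after /follows /=; case: u => /=; lia.
  do 2 congr andb; apply: eq_overpartition_in => -[b v] /=.
  by rewrite /parts_upto /parts_after /follows /=; case: v => /=; lia.
rewrite (_ : parts_upto m (a, u) = false) /=; last by rewrite /parts_upto /=; lia.
have -> : ((a, u) == (m.+1, false)) = parts_after m.+1 (a, u).
  by rewrite /parts_after /follows /= xpair_eqE; case: u => /=; lia.
case: (boolP (parts_after _ _)) => //=; rewrite /parts_after /follows /= => hau.
have -> : a = m.+1 by lia.
congr andb; apply: eq_overpartition_in => -[b v] /=.
by rewrite /parts_after /follows /=; case: v => /=; lia.
Qed.

Lemma mem_enum_upto (m n : nat) (s : marked_seq) :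
  (s \in enum_upto m n) = overpartition_in (parts_upto m) n s.
Proof.
elim: m n s => [|m IH] n s /=.
  case: s => [|x s]; first by rewrite [RHS]eq_sym; case: eqP.
  rewrite overpartition_in_cons /parts_upto.
  by rewrite (_ : (0 < x.1 <= 0)%N = false); [case: ifP | lia].
rewrite mem_cat IH; case: s => [|x s].
  by case: ifP; rewrite !(mem_cat, nil_notin_map_cons, orbF).
have -> : (x :: s \in if (m < n)%N then
    [seq (m.+1, true) :: t | t <- enum_after (enum_upto m) m n (n - m.+1)] ++
    [seq (m.+1, false) :: t | t <- enum_after (enum_upto m) m n (n - m.+1)] else [::])
   = [&& x.1 == m.+1, (m < n)%N & overpartition_in (parts_after m.+1) (n - m.+1) s].
  case: ifP => mn; last by rewrite andbF.
  rewrite mem_cat !mem_map_cons mem_enum_after; [|exact: IH|exact: leq_subr].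
  by case: x => a [] /=; rewrite !xpair_eqE /= ?andbF ?andbT ?orbF.
rewrite !overpartition_in_cons; case: x => a u /=.
have [/= le_am|lt_ma] := leqP a m.
  rewrite (_ : (a == m.+1) = false) ?orbF; last by lia.
  rewrite (_ : parts_upto m (a, u) = parts_upto m.+1 (a, u)); last first.
    by rewrite /parts_upto /=; lia.
  do 2 congr andb; apply: eq_overpartition_in => -[b v] /=.
  by rewrite /parts_upto /follows /=; case: v => /=; lia.
rewrite (_ : parts_upto m (a, u) = false) /=; last by rewrite /parts_upto /=; lia.
have -> : (a == m.+1) = parts_upto m.+1 (a, u) by rewrite /parts_upto /=; lia.
case: (boolP (parts_upto _ _)) => //=; rewrite /parts_upto /= => hau.
have -> : a = m.+1 by lia.
congr andb; apply: eq_overpartition_in => -[b v] /=.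
by rewrite /parts_after /follows /=; case: v => /=; lia.
Qed.

Lemma cons_inj (x : nat * bool) : injective (cons x).
Proof. by move=> s t []. Qed.

Lemma notin_enum_upto (m n : nat) (b : bool) (s : marked_seq) :
  (m.+1, b) :: s \notin enum_upto m n.
Proof. by rewrite mem_enum_upto overpartition_in_cons /parts_upto /= ltnn. Qed.

Lemma uniq_enum_after (m f n : nat) :
  (forall n, uniq (enum_upto m n)) -> uniq (enum_after (enum_upto m) m f n).
Proof.
move=> IHm; elim: f n => [|f IHf] n /=; first by rewrite cats0.
case: ifP => _; last by rewrite cats0.
rewrite cat_uniq IHm (map_inj_uniq (@cons_inj _)) IHf andbT.
by apply/hasPn => _ /mapP[s _ ->]; exact: notin_enum_upto.
Qed.

Lemma uniq_enum_upto (m n : nat) : uniq (enum_upto m n).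
Proof.
elim: m n => [|m IH] n /=; first by case: ifP.
case: ifP => _; last by rewrite cats0.
rewrite cat_uniq IH /= cat_uniq !(map_inj_uniq (@cons_inj _)) !uniq_enum_after //= !andbT.
apply/andP; split; last by apply/hasPn => _ /mapP[s _ ->]; apply/mapP => -[].
apply/hasPn => s; rewrite mem_cat => /orP[] /mapP[t _ ->]; exact: notin_enum_upto.
Qed.

(** With enough fuel, both lists are duplicate-free and have the members described by
    [mem_enum_after]. *)
Lemma size_enum_after_fuel (m f g n : nat) : (n <= f)%N -> (n <= g)%N ->
  size (enum_after (enum_upto m) m f n) = size (enum_after (enum_upto m) m g n).
Proof.
move=> nf ng; apply/perm_size/uniq_perm; try exact/uniq_enum_after/uniq_enum_upto.
by move=> s; rewrite !mem_enum_after //; exact: mem_enum_upto.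
Qed.

(** Either no m+1 occurs or one plain copy is removed: D = C_m + q^(m+1) D for the generating
    function D of these lists. *)
Lemma size_enum_after (m n : nat) :
  size (enum_after (enum_upto m) m n n) =
  (size (enum_upto m n) +
   if m < n then size (enum_after (enum_upto m) m (n - m.+1) (n - m.+1)) else 0)%N.
Proof.
case: n => [|n] /=; first by rewrite cats0 addn0.
rewrite size_cat; case: ifP => // _; rewrite size_map; congr addn.
by apply: size_enum_after_fuel => //; lia.
Qed.

(** The factor 2 is the choice of overlining the first m+1, if there is one: C_(m+1) = C_m + 2
    q^(m+1) D. *)
Lemma size_enum_uptoS (m n : nat) :
  size (enum_upto m.+1 n) =
  (size (enum_upto m n) +
   if m < n then 2 * size (enum_after (enum_upto m) m (n - m.+1) (n - m.+1)) else 0)%N.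
Proof.
rewrite /= size_cat; case: ifP => // _; rewrite size_cat !size_map addnn -mul2n.
by congr (_ + 2 * _)%N; apply: size_enum_after_fuel => //; lia.
Qed.

(* The coefficientwise form of [(1 - q^(m+1)) C_(m+1) = (1 + q^(m+1)) C_m]. *)
Lemma size_enum_upto_rec (m n : nat) :
  (size (enum_upto m.+1 n) =
   (if m < n then size (enum_upto m.+1 (n - m.+1)) + size (enum_upto m (n - m.+1)) else 0)
   + size (enum_upto m n))%N.
Proof.
rewrite size_enum_uptoS; case: ifP => _; last by rewrite addn0.
rewrite size_enum_uptoS size_enum_after; case: ifP => _; lia.
Qed.

(** No part exceeds the weight, so the bound [N] excludes nothing. *)
Lemma mem_enum_upto_weight (N i : nat) (s : marked_seq) : (i <= N)%N ->
  (s \in enum_upto N i) = is_overpartition s && (weight s == i).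
Proof.
move=> le_iN; rewrite mem_enum_upto is_overpartitionE /overpartition_in -andbA; congr andb.
have [ws|] := eqP; last by rewrite !andbF.
rewrite !andbT; apply: eq_in_all => x sx; rewrite /parts_upto.
suff -> : (x.1 <= N)%N by rewrite andbT.
by apply: leq_trans le_iN; rewrite -ws; apply/mem_leq_sumn/(map_f fst sx).
Qed.

(** * Enumerating tuples of overpartitions *)

Fixpoint enum_tuples (N k n : nat) : seq (seq marked_seq) :=
  if k is k'.+1 then
    flatten [seq [seq s :: t | s <- enum_upto N i, t <- enum_tuples N k' (n - i)]
            | i <- iota 0 n.+1]
  else if n == 0%N then [:: [::]] else [::].

Lemma mem_enum_tuples (N k n : nat) (t : seq marked_seq) : (n <= N)%N ->
  (t \in enum_tuples N k n) = (size t == k) && is_overpartition_tuple n t.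
Proof.
elim: k n t => [|k IH] n t le_nN.
  rewrite /=; case: t => [|s t] /=; last by case: ifP.
  by rewrite /is_overpartition_tuple /= [_ == n]eq_sym; case: eqP.
apply/flatten_mapP/idP => [[i]|].
  rewrite mem_iota add0n ltnS => /= le_in /allpairsP[[s u] /= [sN uN ->]] /=.
  move: sN uN; rewrite mem_enum_upto_weight ?(leq_trans le_in) //.
  rewrite IH ?(leq_trans (leq_subr _ _)) // /is_overpartition_tuple /=.
  case/andP=> -> /eqP ws /and3P[/eqP -> -> /eqP wu].
  by rewrite eqxx ws wu /= subnKC.
case: t => [|s t] //=; rewrite eqSS /is_overpartition_tuple /=.
case/and3P=> st /andP[os ot] /eqP w; exists (weight s).
  by rewrite -[0%N :: _]/(iota 0 n.+1) mem_iota /= add0n ltnS -w leq_addr.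
apply/allpairsP; exists (s, t); split=> //=.
  by rewrite mem_enum_upto_weight ?os ?eqxx // (leq_trans _ le_nN) // -w leq_addr.
rewrite IH; last exact: leq_trans (leq_subr _ _) le_nN.
by rewrite st /is_overpartition_tuple ot -w addKn eqxx.
Qed.

Lemma uniq_flatten_map (I : eqType) (T : eqType) (F : I -> seq T) (r : seq I) :
  uniq r -> (forall i, i \in r -> uniq (F i)) ->
  (forall i j x, i \in r -> j \in r -> x \in F i -> x \in F j -> i = j) ->
  uniq (flatten [seq F i | i <- r]).
Proof.
elim: r => //= i r IH /andP[nir ur] uF dF.
rewrite cat_uniq uF ?mem_head //= IH ?andbT //.
- apply/hasPn => x /flatten_mapP[j jr xj]; apply/negP => xi.
  by move: nir; rewrite (dF i j x (mem_head _ _) _ xi xj) ?jr // inE jr orbT.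
- by move=> j jr; apply: uF; rewrite inE jr orbT.
- by move=> j l x jr lr; apply: dF; rewrite inE ?jr ?lr orbT.
Qed.

Lemma uniq_enum_tuples (N k n : nat) : (n <= N)%N -> uniq (enum_tuples N k n).
Proof.
elim: k n => [|k IH] n le_nN; first by rewrite /=; case: ifP.
apply: uniq_flatten_map; first exact: iota_uniq.
  move=> i _; apply: allpairs_uniq; first exact: uniq_enum_upto.
    by apply: IH; exact: leq_trans (leq_subr _ _) le_nN.
  by move=> [s t] [s' t'] _ _ /= [-> ->].
(* The blocks are disjoint because the weight of the first component gives back the index. *)
move=> i j x; rewrite !mem_iota !add0n !ltnS /= => le_in le_jn.
case/allpairsP=> -[s t] /= [si _ ->] /allpairsP[[s' t'] /= [sj _ [es _]]].
move: si sj; rewrite -es !mem_enum_upto_weight ?(leq_trans le_in) ?(leq_trans le_jn) //.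
by case/andP=> _ /eqP <- /andP[_ /eqP <-].
Qed.

Lemma overp_size (N k n : nat) : (n <= N)%N -> overp k n = size (enum_tuples N k n).
Proof.
move=> le_nN; rewrite /overp cardE.
pose g (w : k.-tuple (bounded_marked_seq n)) := [seq unbound b | b <- w].
have g_inj : injective g by move=> v w /(inj_map (@unbound_inj n)) /val_inj.
rewrite -(size_map g); apply/perm_size/uniq_perm.
- by rewrite (map_inj_uniq g_inj) enum_uniq.
- exact: uniq_enum_tuples.
move=> t; rewrite mem_enum_tuples //; apply/mapP/andP => [[w + ->]|[/eqP st ot]].
  by rewrite mem_enum inE /g => ->; rewrite size_map size_tuple.
have [w w_in <-] := overpartition_tuple_bounded st ot.
by exists w; rewrite ?mem_enum.
Qed.

Lemma size_enum_tuplesS (N k n : nat) :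
  size (enum_tuples N k.+1 n) =
  (\sum_(i < n.+1) size (enum_upto N i) * size (enum_tuples N k (n - i)))%N.
Proof.
rewrite -[enum_tuples _ _ _]/(flatten
  [seq [seq s :: t | s <- enum_upto N i, t <- enum_tuples N k (n - i)] | i <- iota 0 n.+1]).
rewrite size_flatten /shape -map_comp sumnE big_map.
rewrite -[iota _ _]/(index_iota 0 n.+1) big_mkord.
by apply: eq_bigr => i _ /=; rewrite size_allpairs.
Qed.

(** * Gauss's identity and the expansion modulo 16 *)

(* Shanks' finite form of Gauss's identity, cleared of denominators.  The difference
   of the sums over [s] for [n.+1] and [n] telescopes; [step] is its partial sum. *)
Lemma finite_gauss (R : comNzRingType) (q : R) (n : nat) :
  (1 + 2 * \sum_(1 <= j < n.+1) (-1) ^+ j * q ^+ (j ^ 2)) * \prod_(0 <= i < n) (1 + q ^+ i.+1) =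
  \prod_(0 <= i < n) (1 - q ^+ i.+1) +
  2 * \sum_(1 <= s < n.+1) (-1) ^+ s * (\prod_(0 <= i < s.-1) (1 + q ^+ i.+1)) *
     (\prod_(s <= i < n) (1 - q ^+ i.+1)) * q ^+ (s * n.+1).
Proof.
elim: n => [|n IH]; first by rewrite !big_geq // mulr0 addr0 mulr1.
rewrite (big_nat_recr n.+1) //= (big_nat_recr n 0) //= (big_nat_recr n 0) //=.
set T := \sum_(_ <= _ < _) _ in IH *.
set b := \prod_(_ <= _ < _) (1 + _) in IH *.
set a := \prod_(_ <= _ < _) (1 - _) in IH *.
rewrite [in RHS](big_nat_recr n.+1) //= -/b [\prod_(n.+1 <= i < n.+1) _]big_geq // mulr1.
have step t : (t <= n)%N ->
  2 * (\sum_(1 <= s < t.+1) (-1) ^+ s * (\prod_(0 <= i < s.-1) (1 + q ^+ i.+1)) *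
         (\prod_(s <= i < n.+1) (1 - q ^+ i.+1)) * q ^+ (s * n.+2)) =
  2 * (1 + q ^+ n.+1) *
    (\sum_(1 <= s < t.+1) (-1) ^+ s * (\prod_(0 <= i < s.-1) (1 + q ^+ i.+1)) *
       (\prod_(s <= i < n) (1 - q ^+ i.+1)) * q ^+ (s * n.+1))
  + 2 * q ^+ n.+1 * a
  - 2 * (-1) ^+ t * (\prod_(t <= i < n) (1 - q ^+ i.+1)) *
     (\prod_(0 <= i < t) (1 + q ^+ i.+1)) * q ^+ (t.+1 * n.+1).
  elim: t => [|t IHt] le_tn.
    do 2 rewrite [\sum_(1 <= s < 1) _]big_geq //.
    rewrite !mulr0 add0r -/a [\prod_(0 <= i < 0) _]big_geq // mul1n; ring.
  rewrite (big_nat_recr t.+1) //= [in RHS](big_nat_recr t.+1) //= mulrDr (IHt (ltnW le_tn)).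
  (* All products are reduced to common ones by splitting off their end factors; what remains is a
     polynomial identity in these and in powers of [q]. *)
  rewrite (big_ltn le_tn) (big_nat_recr n t.+1) //= (big_nat_recr t 0) //=.
  set A := \sum_(_ <= _ < _) _; set B := \prod_(_ <= _ < _) _; set C := \prod_(_ <= _ < _) _.
  rewrite !mulSn !mulnS !exprD !exprS.
  set x := q ^+ n; set y := q ^+ t; set z := q ^+ (t * n).
  ring.
(* At t = n the boundary term of [step] is [b] times the new theta term, the one for j = n+1. *)
have := step n (leqnn n); rewrite [\prod_(n <= i < n) _]big_geq // -/b => step_n.
rewrite [in RHS](mulrDr 2) step_n.
set A := \sum_(_ <= _ < _) _ in IH *.
have -> : (1 + 2 * (T + (-1) ^+ n.+1 * q ^+ (n.+1 ^ 2))) * (b * (1 + q ^+ n.+1)) =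
  ((1 + 2 * T) * b) * (1 + q ^+ n.+1) + 2 * (-1) ^+ n.+1 * q ^+ (n.+1 ^ 2) * b * (1 + q ^+ n.+1)
  by ring.
rewrite IH -mulnn [(n.+1 * n.+2)%N]mulnS exprD [(-1) ^+ n.+1]exprS.
ring.
Qed.

(** * Congruence of polynomials modulo X^M, in place of power series *)

Definition eqmodX (R : nzRingType) (M : nat) (p q : {poly R}) : Prop :=
  forall i, (i < M)%N -> p`_i = q`_i.

Lemma eqmodXM (R : comNzRingType) (M : nat) (p p' q q' : {poly R}) :
  eqmodX R M p p' -> eqmodX R M q q' -> eqmodX R M (p * q) (p' * q').
Proof.
move=> hp hq i iM; rewrite !coefM; apply: eq_bigr => j _.
by rewrite hp ?hq //; case: j => j /= ; lia.
Qed.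

Lemma eqmodXX (R : comNzRingType) (M : nat) (p q : {poly R}) (k : nat) :
  eqmodX R M p q -> eqmodX R M (p ^+ k) (q ^+ k).
Proof.
move=> h; elim: k => [|k IH]; first by move=> i; rewrite !expr0.
by rewrite !exprS; exact: eqmodXM.
Qed.

(** A constant term 1 lets the coefficients of a factor be recovered one after another from those of
    the product. *)
Lemma eqmodX_cancel (R : comNzRingType) (M : nat) (b p q : {poly R}) :
  b`_0 = 1 -> eqmodX R M (b * p) (b * q) -> eqmodX R M p q.
Proof.
move=> b0 h i; elim/ltn_ind: i => i IH iM.
have := h i iM; rewrite !coefM !big_ord_recl b0 !mul1r !subn0.
rewrite (eq_bigr (fun j : 'I_i => b`_(lift ord0 j) * q`_(i - lift ord0 j))) => [/addIr //|j _].
by rewrite IH //; case: j => j /= ; rewrite /bump /=; lia.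
Qed.

(** This is the geometric series of 1/(1 + 2S) cut after the cube, with its exact remainder. *)
Lemma inverse_expansion (R : comNzRingType) (M : nat) (P S : {poly R}) :
  S`_0 = 0 -> eqmodX R M (P * (1 + 2 * S)) 1 ->
  eqmodX R M P (1 - 2 * S + 4 * S ^+ 2 - 8 * S ^+ 3 + 16 * (S ^+ 4 * P)).
Proof.
move=> S0 h; apply: (@eqmodX_cancel _ _ (1 + 2 * S)).
  by rewrite coefD coef1 -[2]/(2%:R) mulr_natl coefMn S0 mul0rn addr0.
move=> i iM; rewrite [(1 + 2 * S) * P]mulrC h //.
have -> : (1 + 2 * S) * (1 - 2 * S + 4 * S ^+ 2 - 8 * S ^+ 3 + 16 * (S ^+ 4 * P)) =
  1 + (16 * S ^+ 4) * (P * (1 + 2 * S) - 1) by ring.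
have /(_ i iM) : eqmodX R M ((16 * S ^+ 4) * (P * (1 + 2 * S) - 1)) ((16 * S ^+ 4) * 0).
  by apply: eqmodXM => // j jM; rewrite coefB h // subrr coef0.
by rewrite mulr0 coef0 => e0; rewrite coefD e0 addr0.
Qed.

(** The coefficients are those of (1 + 2S)^(-k); the induction on [k] is Pascal's rule. *)
Lemma expansion_exp (R : comNzRingType) (S z : R) (k : nat) :
  exists w, (1 - 2 * S + 4 * S ^+ 2 - 8 * S ^+ 3 + 16 * z) ^+ k =
    1 - (2 * k)%:R * S + (4 * 'C(k.+1, 2))%:R * S ^+ 2 - (8 * 'C(k.+2, 3))%:R * S ^+ 3 + 16 * w.
Proof.
elim: k => [|k [w IH]]; first by exists 0; rewrite expr0 !bin_small //; ring.
rewrite exprS IH.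
rewrite [('C(k.+3, 3))]binS [('C(k.+2, 2))]binS bin1.
set b := 'C(k.+1, 2); set c := 'C(k.+2, 3).
(* The witness gathers what carries a factor 16: the terms in [w] and [z], and the products of
   degree 4 to 6 in [S]. *)
exists ((1 - 2 * S + 4 * S ^+ 2 - 8 * S ^+ 3 + 16 * z) * w +
  z * (1 - (2 * k)%:R * S + (4 * b)%:R * S ^+ 2 - (8 * c)%:R * S ^+ 3)
  + (c + b + k)%:R * S ^+ 4 - (2 * (c + b))%:R * S ^+ 5 + (4 * c)%:R * S ^+ 6).
ring.
Qed.

(** Each cross term of the square occurs twice. *)
Lemma sum_sqr (R : comNzRingType) (x : nat -> R) (m n : nat) :
  exists f, (\sum_(m <= j < n) x j) ^+ 2 = \sum_(m <= j < n) x j ^+ 2 + 2 * f.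
Proof.
elim: n => [|n [f IH]]; first by exists 0; rewrite !big_geq // mulr0 addr0 expr0n.
have [le_mn|lt_nm] := leqP m n; last by exists 0; rewrite !big_geq // mulr0 addr0 expr0n.
rewrite !big_nat_recr //= sqrrD IH.
by exists (f + (\sum_(m <= i < n) x i) * x n); ring.
Qed.

(** * The generating function of overpartitions and Gauss's identity up to degree N *)

Definition gf_upto (N m : nat) : {poly int} :=
  \poly_(i < N.+1) (size (enum_upto m i))%:Z.

Lemma gf_uptoS (N m : nat) :
  eqmodX _ N.+1 ((1 - 'X^(m.+1)) * gf_upto N m.+1) ((1 + 'X^(m.+1)) * gf_upto N m).
Proof.
move=> i iN; rewrite mulrBl mulrDl !mul1r coefB coefD !coefXnM /gf_upto !coef_poly iN.
rewrite size_enum_upto_rec; case: (leqP m.+1 i) => [le_mi|lt_im]; last first.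
  by lia.
rewrite (_ : i - m.+1 < N.+1)%N; lia.
Qed.

Lemma gf_upto0 (N : nat) : eqmodX _ N.+1 (gf_upto N 0) 1.
Proof. by move=> i iN; rewrite coef_poly iN coef1 /=; case: i iN. Qed.

(** Iterating [gf_uptoS] gives the product of the (1 + q^i)/(1 - q^i), here cleared of
    denominators. *)
Lemma gf_upto_prod (N m : nat) :
  eqmodX _ N.+1 ((\prod_(0 <= i < m) (1 - 'X^(i.+1))) * gf_upto N m)
                (\prod_(0 <= i < m) (1 + 'X^(i.+1))).
Proof.
elim: m => [|m IH] i iN.
  by rewrite !big_geq // mul1r gf_upto0.
rewrite !(big_nat_recr m 0) //= -mulrA.
rewrite (eqmodXM _ _ _ _ _ _ (fun _ _ => erefl) (@gf_uptoS N m)) //.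
by rewrite mulrCA mulrC (eqmodXM _ _ _ _ _ _ IH (fun _ _ => erefl)).
Qed.

Lemma prod1X_coef0 (m : nat) : (\prod_(0 <= i < m) (1 + 'X^(i.+1)) : {poly int})`_0 = 1.
Proof.
rewrite -horner_coef0 horner_prod big1 // => i _.
by rewrite !hornerE expr0n /= addr0.
Qed.

(** [1 + 2 * half_theta N] agrees with the theta series φ(-q) up to degree [N]. *)
Definition half_theta (N : nat) : {poly int} :=
  \sum_(1 <= j < N.+1) (-1) ^+ j * 'X^(j ^ 2).

Lemma gauss_mod (N : nat) : eqmodX _ N.+1 (gf_upto N N * (1 + 2 * half_theta N)) 1.
Proof.
(* Multiplying by the product of the 1 + X^(i+1) makes [finite_gauss] applicable; [gf_upto_prod]
   then gives the main term. *)
apply: (eqmodX_cancel _ _ _ _ _ (prod1X_coef0 N)) => i iN.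
have -> : (\prod_(0 <= i < N) (1 + 'X^(i.+1))) * (gf_upto N N * (1 + 2 * half_theta N)) =
  gf_upto N N * ((1 + 2 * half_theta N) * \prod_(0 <= i < N) (1 + 'X^(i.+1))) by ring.
rewrite (finite_gauss _ ('X : {poly int})) mulr1.
set a := \prod_(_ <= _ < _) (1 - _); set E := \sum_(_ <= _ < _) _.
rewrite mulrDr coefD [gf_upto N N * a]mulrC gf_upto_prod //.
suff [r ->] : exists r, E = 'X^(N.+1) * r.
  rewrite (_ : gf_upto N N * _ = 'X^(N.+1) * (2 * gf_upto N N * r)); last by ring.
  by rewrite coefXnM iN addr0.
(* Every exponent s(N+1) has s >= 1, so X^(N+1) factors out and leaves [s.-1]. *)
exists (\sum_(1 <= s < N.+1) (-1) ^+ s * (\prod_(0 <= i < s.-1) (1 + 'X^(i.+1))) *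
     (\prod_(s <= i < N) (1 - 'X^(i.+1))) * 'X^(s.-1 * N.+1)).
rewrite big_distrr /=; apply: eq_big_nat => -[|s] // _.
by rewrite mulSn exprD /=; ring.
Qed.

Lemma gf_exp_coef (N k n : nat) : (n <= N)%N ->
  (gf_upto N N ^+ k)`_n = (size (enum_tuples N k n))%:Z.
Proof.
elim: k n => [|k IH] n le_nN; first by rewrite expr0 coef1 /=; case: eqP.
rewrite exprS coefM size_enum_tuplesS (big_morph Posz PoszD (erefl _)).
apply: eq_bigr => -[i lt_in] _ /=; rewrite IH; last by lia.
by rewrite /gf_upto coef_poly PoszM (_ : (i < N.+1)%N); last by lia.
Qed.

(** * Coefficients of the theta sum and of its square *)

Lemma coef_signXn (j e n : nat) :
  (((-1) ^+ j * 'X^e) : {poly int})`_n = (-1) ^+ j * (n == e)%:R.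
Proof.
rewrite -[in LHS]signr_odd -[in RHS]signr_odd.
by case: (odd j); rewrite !(expr0, expr1, mulN1r, mul1r, coefN, coefXn).
Qed.

Lemma half_theta_square (N n : nat) : (0 < n <= N)%N -> is_square n ->
  (half_theta N)`_n = (-1) ^+ n.
Proof.
move=> /andP[n0 nN] [j ej]; rewrite /half_theta coef_sum.
have j0 : (0 < j)%N by move: n0; rewrite ej; case: (j).
have jN : (j <= N)%N by apply: leq_trans nN; rewrite ej -mulnn leq_pmull.
rewrite (bigD1_seq j) /= ?mem_index_iota ?iota_uniq ?j0 //.
rewrite coef_signXn -ej eqxx mulr1 big1 ?addr0 => [|i ij].
  (* The sign is (-1)^j, and j^2 has the parity of j. *)
  by rewrite -[RHS]signr_odd ej oddX /= signr_odd.
by rewrite coef_signXn ej eqn_exp2r // eq_sym (negPf ij) mulr0.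
Qed.

Lemma half_theta_nonsquare (N n : nat) : ~ is_square n -> (half_theta N)`_n = 0.
Proof.
move=> nsq; rewrite /half_theta coef_sum big1 // => j _.
by rewrite coef_signXn; case: eqP => [e|]; [case: nsq; exists j | rewrite mulr0].
Qed.

Lemma half_theta_sqr (N : nat) : exists F,
  half_theta N ^+ 2 = \sum_(1 <= j < N.+1) 'X^(2 * j ^ 2) + 2 * F.
Proof.
have [F ->] := sum_sqr _ (fun j => (-1) ^+ j * 'X^(j ^ 2) : {poly int}) 1 N.+1.
exists F; congr (_ + _); apply: eq_bigr => j _.
by rewrite exprMn sqrr_sign mul1r -exprM mulnC.
Qed.

Lemma twice_theta_coef (N n : nat) : (0 < n <= N)%N -> is_twice_square n ->
  (\sum_(1 <= j < N.+1) 'X^(2 * j ^ 2) : {poly int})`_n = 1.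
Proof.
move=> /andP[n0 nN] [j ej]; rewrite coef_sum.
have j0 : (0 < j)%N by move: n0; rewrite ej; case: (j).
have jN : (j <= N)%N by apply: leq_trans nN; rewrite ej -mulnn; nia.
rewrite (bigD1_seq j) /= ?mem_index_iota ?iota_uniq ?j0 //.
rewrite coefXn -ej eqxx big1 ?addr0 // => i ij.
by rewrite coefXn ej eqn_pmul2l // eqn_exp2r // eq_sym (negPf ij).
Qed.

Lemma twice_theta_coef0 (N n : nat) : ~ is_twice_square n ->
  (\sum_(1 <= j < N.+1) 'X^(2 * j ^ 2) : {poly int})`_n = 0.
Proof.
move=> nsq; rewrite coef_sum big1 // => j _.
by rewrite coefXn; case: eqP => [e|//]; case: nsq; exists j.
Qed.

(** The exponent of 2 is even in a nonzero square and odd in twice one. *)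
Lemma square_not_twice_square (n : nat) : (0 < n)%N -> is_square n -> ~ is_twice_square n.
Proof.
move=> n0 [i ei] [j ej].
have j0 : (0 < j)%N by move: n0; rewrite ej; case: (j).
have i0 : (0 < i)%N by move: n0; rewrite ei; case: (i).
have := congr1 (fun m => odd (logn 2 m)) (etrans (esym ei) ej).
by rewrite lognM ?expn_gt0 ?j0 // !lognX oddD !oddM.
Qed.

Lemma coefMnat (m : nat) (p : {poly int}) (n : nat) : (m%:R * p)`_n = m%:Z * p`_n.
Proof. by rewrite mulr_natl coefMn -mulr_natl natz. Qed.

(** * The coefficient of q^n modulo 8 and modulo 16 *)

Lemma overp_expansion (k n : nat) : (0 < n)%N -> exists f c w : int,
  (overp k n)%:Z =
    - (2 * k%:Z * (half_theta n)`_n)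
    + 4 * 'C(k.+1, 2)%:Z * ((\sum_(1 <= j < n.+1) 'X^(2 * j ^ 2) : {poly int})`_n + 2 * f)
    - 8 * 'C(k.+2, 3)%:Z * c + 16 * w.
Proof.
move=> n0; rewrite (overp_size n k n) // -gf_exp_coef //.
set P := gf_upto n n; set S := half_theta n.
have S0 : S`_0 = 0.
  rewrite /S /half_theta coef_sum big_nat_cond big1 // => j /andP[/andP[j0 _] _].
  by rewrite coef_signXn eq_sym expn_eq0; case: j j0 => // j _; rewrite mulr0.
have hP := inverse_expansion _ _ _ _ S0 (@gauss_mod n).
rewrite (eqmodXX _ _ _ _ k hP) //.
have [w ->] := expansion_exp _ S (S ^+ 4 * P) k.
have [F eF] := half_theta_sqr n.
exists F`_n, (S ^+ 3)`_n, w`_n.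
rewrite -/S in eF; rewrite coefD coefB coefD coefB !coefMnat coef1 eF coefD !coefMnat.
by rewrite gtn_eqF // !PoszM mulr0n sub0r.
Qed.

Lemma overp_mod (k n : nat) : (0 < n)%N -> exists z : int,
  (overp k n)%:Z =
    z * 2 ^+ modexp k +
    (- (2 * k%:Z * (half_theta n)`_n)
     + 2 * k%:Z * (k%:Z + 1) * (\sum_(1 <= j < n.+1) 'X^(2 * j ^ 2) : {poly int})`_n).
Proof.
move=> n0; have [f [c [w ->]]] := overp_expansion k n n0.
have eb : 2 * 'C(k.+1, 2)%:Z = k%:Z * (k%:Z + 1).
  by have := mul_bin_diag k.+1 1; rewrite bin1 => e; rewrite -PoszM -e PoszM; lia.
have ec : 3 * 'C(k.+2, 3)%:Z = (k%:Z + 2) * 'C(k.+1, 2)%:Z.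
  by have := mul_bin_diag k.+2 2 => /= e; rewrite -PoszM -e PoszM; lia.
set b := 'C(k.+1, 2)%:Z in eb ec *; set C := 'C(k.+2, 3)%:Z in ec *.
set T := (polyseq (\sum_(_ <= _ < _) _))`_n; rewrite -(mulrA 2 k%:Z (k%:Z + 1)) -eb /modexp.
(* Modulo 8 the terms in [f], [c] and [w] vanish as they stand. Modulo 16 this needs [b] and [C] to
   be even. *)
case: ifP => hk; last by exists (b * f - C * c + 2 * w); ring.
(* One of k and k+1 is a multiple of 4, so half of k(k+1) is even. *)
have [b' eb'] : exists b', b = 2 * b'.
  have ek := divn_eq k 4; set a := (k %/ 4)%N in ek.
  case/orP: hk => /eqP hk; rewrite hk in ek.
    by exists (a%:Z * (4 * a%:Z + 1)); move: eb; rewrite ek; lia.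
  by exists ((4 * a%:Z + 3) * (a%:Z + 1)); move: eb; rewrite ek; lia.
(* By [ec] and the parity of [b], 3C is even, hence so is C. *)
have [c' ec'] : exists c', C = 2 * c'.
  exists (C %/ 2)%Z; rewrite eb' mulrCA in ec.
  by move: ec; set y := (_ + 2) * b'; lia.
by exists (b' * f - c' * c + w); rewrite eb' ec'; ring.
Qed.

Theorem theorem2p1 (k : nat) (hk : (1 <= k)%N) (n : nat) (hn : (1 <= n)%N) :
  [/\ (is_square n -> ~~ odd n ->
        ((overp k n)%:Z = - (2 * k%:Z) %[mod 2 ^+ modexp k])%Z),
      (is_square n -> odd n ->
        ((overp k n)%:Z = 2 * k%:Z %[mod 2 ^+ modexp k])%Z),
      (is_twice_square n ->
        ((overp k n)%:Z = 2 * k%:Z * (k%:Z + 1) %[mod 2 ^+ modexp k])%Z)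
    & (~ is_square n -> ~ is_twice_square n ->
        ((overp k n)%:Z = 0 %[mod 2 ^+ modexp k])%Z)].
Proof.
have [z ->] := overp_mod k n hn; have nn : (0 < n <= n)%N by rewrite hn leqnn.
(* The cases exclude each other, so at most one of the two coefficients in [overp_mod] is
   nonzero. *)
have sq_tw := square_not_twice_square n hn.
split.
- move=> sq ev; rewrite modzMDl half_theta_square // twice_theta_coef0; last exact: sq_tw.
  by rewrite -signr_odd (negPf ev) mulr1 mulr0 addr0.
- move=> sq od; rewrite modzMDl half_theta_square // twice_theta_coef0; last exact: sq_tw.
  by rewrite -signr_odd od expr1 mulrN1 opprK mulr0 addr0.
- move=> tw; rewrite modzMDl half_theta_nonsquare ?twice_theta_coef //; last by move/sq_tw.
  by rewrite mulr0 oppr0 add0r mulr1.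
- move=> nsq ntw; rewrite modzMDl half_theta_nonsquare // twice_theta_coef0 //.
  by rewrite !mulr0 oppr0 addr0.
Qed.
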